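(* For the merging problem with $n=3$ items and $k=2$ slots (with $a_i\ge0$ almost surely and $o_i\ge 0$), the G-FIX mechanism is $(4/5)^3$-approximate: $\mathrm{OBJ}(\mathcal M^F)\ge (4/5)^3\,\mathrm{OBJ}(\mathcal M^* )$, where $\mathcal M^*$ is an optimal mechanism.
   Context: Merging problem: $n$ items indexed by $[n]$, $k\le n$ slots. Each item $i$ has a random ad value $a_i$, drawn independently from a regular distribution $G_i$ ($\boldsymbol a\sim G=\times_i G_i$), and a fixed organic value $o_i\ge0$. A mechanism is a pair of allocation rules $x,y$ with $x_i(\boldsymbol a),y_i(\boldsymbol a)\in\{0,1\}$ ($x_i=1$: item $i$ shown as ad; $y_i=1$: shown organically) satisfying for all $\boldsymbol a,i$: (i) $\sum_i(x_i+y_i)\le k$; (ii) $x_i+y_i\le 1$; (iii) $y_i(a_i,\boldsymbol a_{-i})$ independent of $a_i$; (iv) $x_i(a_i,\boldsymbol a_{-i})$ non-decreasing in $a_i$. Objective $\mathrm{OBJ}=\mathbb E_{\boldsymbol a\sim G}[\sum_i(a_ix_i(\boldsymbol a)+o_iy_i(\boldsymbol a))]$; $\mathcal M^*$ maximizes it subject to (i)–(iv). A mechanism $\mathcal M$ is $\tau$-approximate if $\mathrm{OBJ}(\mathcal M)/\mathrm{OBJ}(\mathcal M^* )\ge\tau$. Notation: for a finite multiset $S$ of reals and $k\le|S|$, $\max^{(k)}S$ is the sum of the $k$ largest elements of $S$. G-FIX-$I$ mechanism $\mathcal M^F_I$ for $I\subseteq[n]$: items in $I$ may only be shown in organic form and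 items outside $I$ only as ads; with $L=\{o_i:i\in I\}\cup\{a_i:i\in[n]\setminus I\}$, it displays (in the designated forms) the $k$ items with the largest values in $L$, i.e. $x_i(\boldsymbol a)=1$ iff $i\notin I$ and $a_i>\max^{(k+1)}L-\max^{(k)}L$, $y_i(\boldsymbol a)=1$ iff $i\in I$ and $o_i>\max^{(k+1)}L-\max^{(k)}L$. Its objective is $\mathrm{OBJ}(\mathcal M_I^F)=\mathbb E_{\boldsymbol a\sim G}[\max^{(k)}L]$. The G-FIX mechanism $\mathcal M^F$ runs the $\mathcal M^F_I$ with the highest objective among all $I\subseteq[n]$ with $|I|\le k$, so $\mathrm{OBJ}(\mathcal M^F)=\max_{I\subseteq[n],|I|\le k}\mathrm{OBJ}(\mathcal M^F_I)$. *)

(* Defs.v *)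
From HB Require Import structures.
From mathcomp Require Import all_boot all_order all_algebra.
From mathcomp Require Import all_classical all_reals all_analysis.
Set Implicit Arguments. Unset Strict Implicit. Unset Printing Implicit Defensive.
Import Order.TTheory GRing.Theory Num.Theory.
Local Open Scope classical_set_scope.
Local Open Scope ring_scope.

Definition prod3 (R : realType) (G : 'I_3 -> probability R R) :=
  ((G ord0 \x G (inord 1)) \x G (inord 2))%E.

Definition vec3 (R : realType) (p : (R * R) * R) : 'I_3 -> R :=
  fun i => match val i with 0%N => p.1.1 | 1%N => p.1.2 | _ => p.2 end.

Definition Ex3 (R : realType) (G : 'I_3 -> probability R R)
  (h : ('I_3 -> R) -> R) : \bar R :=
  (\int[prod3 G]_p (h (vec3 p))%:E)%E.

Definition topk_sum (R : realType) (k : nat) (s : seq R) : R :=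
  \sum_(x <- take k (sort (fun x y : R => y <= x) s)) x.

Definition cdf (R : realType) (P : probability R R) (x : R) : R :=
  fine (P [set` `]-oo, x]]).

(* Regular distribution (Myerson): it has a density f (w.r.t. Lebesgue measure)
   which is positive on the interior of an interval support (lo, hi) and zero
   outside [lo, hi], and the virtual value  x - (1 - F x) / f x  is
   non-decreasing on (lo, hi). *)
Definition regular (R : realType) (P : probability R R) : Prop :=
  exists (f : R -> R) (lo : R) (hi : \bar R),
    [/\ (lo%:E < hi)%E,
        measurable_fun setT f /\ (forall x, 0 <= f x),
        (forall A, measurable A ->
            P A = (\int[lebesgue_measure]_(x in A) (f x)%:E)%E),
        (forall x, (lo%:E < x%:E < hi)%E -> 0 < f x) /\
        (forall x, (x < lo \/ (hi < x%:E)%E) -> f x = 0) &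
        (forall x y, (lo%:E < x%:E)%E -> x <= y -> (y%:E < hi)%E ->
            x - (1 - cdf P x) / f x <= y - (1 - cdf P y) / f y)].

Definition same_off (R : realType) (i : 'I_3) (a b : 'I_3 -> R) : Prop :=
  forall j, j != i -> a j = b j.

(* A (deterministic) mechanism for the merging problem with n = 3 items and
   k slots: x i a = "item i shown as ad", y i a = "item i shown organically". *)
Definition feasible (R : realType) (k : nat)
  (x y : 'I_3 -> ('I_3 -> R) -> bool) : Prop :=
  [/\ (forall a, (\sum_(i < 3) (x i a + y i a) <= k)%N),
      (forall a i, ~~ (x i a && y i a)),
      (forall i a b, same_off i a b -> y i a = y i b),
      (forall i a b, same_off i a b -> a i <= b i -> x i a -> x i b) &
      (* measurability of the allocation rules, so that OBJ is well defined *)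
      (forall i, measurable_fun setT (fun p : (R * R) * R => ((x i (vec3 p))%:R : R))
              /\ measurable_fun setT (fun p : (R * R) * R => ((y i (vec3 p))%:R : R)))].

Definition OBJ (R : realType) (G : 'I_3 -> probability R R) (o : 'I_3 -> R)
  (x y : 'I_3 -> ('I_3 -> R) -> bool) : \bar R :=
  Ex3 G (fun a => \sum_(i < 3) (a i * (x i a)%:R + o i * (y i a)%:R)).

Definition Llist (R : realType) (I : {set 'I_3}) (o a : 'I_3 -> R) : seq R :=
  [seq (if i \in I then o i else a i) | i <- enum 'I_3].

Definition OBJ_FIX_I (R : realType) (G : 'I_3 -> probability R R) (o : 'I_3 -> R)
  (k : nat) (I : {set 'I_3}) : \bar R :=
  Ex3 G (fun a => topk_sum k (Llist I o a)).

Definition OBJ_FIX (R : realType) (G : 'I_3 -> probability R R) (o : 'I_3 -> R)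
  (k : nat) : \bar R :=
  (\big[Order.max/-oo]_(I : {set 'I_3} | (#|I| <= k)%N) OBJ_FIX_I G o k I)%E.

(* Main.v *)
(* Since y_i does not depend on a_i, integrating over a_i first shows that item i
   contributes at most M_i = max(o_i, E a_i) to the objective of any feasible
   mechanism, whence OBJ <= M_0 + M_1 + M_2. Conversely, for two items j <> k let
   I be the set of those i in {j, k} with o_i >= E a_i: the two largest elements
   of L dominate the entries of j and k, so OBJ(M^F_I) >= M_j + M_k. Averaging
   over the three pairs gives OBJ(M^F) >= (2/3) OBJ, and 2/3 >= (4/5)^3. *)
Require Import Defs.
From HB Require Import structures.
From mathcomp Require Import all_boot all_order all_algebra.
From mathcomp Require Import all_classical all_reals all_analysis.
From mathcomp Require Import measurable_realfun lra.
Import Order.TTheory GRing.Theory Num.Theory.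
Local Open Scope classical_set_scope.
Local Open Scope ring_scope.

(** * Two-sided bounds for integrals against probability and product measures *)

(** A constant integrates to itself under a probability measure; [0 <= c] makes [f] nonnegative, so
    monotonicity applies without integrability. *)
Lemma integral_between {R : realType} d (T : measurableType d)
    (P : probability T R) (f : T -> \bar R) (c e : \bar R) :
  (0 <= c)%E -> measurable_fun setT f -> (forall t, c <= f t <= e)%E ->
  (c <= \int[P]_t f t <= e)%E.
Proof.
move=> c0 mf cfe; have f0 t : (0 <= f t)%E.
  by have /andP[cf _] := cfe t; exact: le_trans cf.
have cstE r : (\int[P]_t cst r t)%E = r.
  by rewrite integral_cst//= probability_setT mule1.
apply/andP; split.
- rewrite -[leLHS]cstE.
  by apply: ge0_le_integral => // t _; have /andP[] := cfe t.
- rewrite -[leRHS]cstE.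
  by apply: ge0_le_integral => // t _; have /andP[] := cfe t.
Qed.

Section Product.
Variables (R : realType) (d1 d2 : measure_display).
Variables (T1 : measurableType d1) (T2 : measurableType d2).
Variables (P1 : probability T1 R) (P2 : probability T2 R).
Variables (f : T1 * T2 -> \bar R) (c e : \bar R).
Hypotheses (c0 : (0 <= c)%E) (mf : measurable_fun setT f).
Hypothesis f0 : forall z, (0 <= f z)%E.

Lemma integral_prod_between_snd :
  (forall x, c <= \int[P2]_y f (x, y) <= e)%E ->
  (c <= \int[(P1 \x P2)%E]_z f z <= e)%E.
Proof.
move=> cfe; rewrite fubini_tonelli1//; apply: integral_between => //.
exact: measurable_fun_fubini_tonelli_F.
Qed.

Lemma integral_prod_between_fst :
  (forall y, c <= \int[P1]_x f (x, y) <= e)%E ->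
  (c <= \int[(P1 \x P2)%E]_z f z <= e)%E.
Proof.
move=> cfe; rewrite fubini_tonelli2//; apply: integral_between => //.
exact: measurable_fun_fubini_tonelli_G.
Qed.

End Product.

(** * Coordinates of a triple, and integrating one of them first *)

Definition upd3 {R : realType} (i : 'I_3) (p : (R * R) * R) (t : R) :
    (R * R) * R :=
  match val i with
  | 0%N => ((t, p.1.2), p.2)
  | 1%N => ((p.1.1, t), p.2)
  | _ => (p.1, t)
  end.

Lemma ord3_cases (i : 'I_3) : [\/ i = ord0, i = inord 1 | i = inord 2].
Proof.
case: i => -[|[|[|//]]] Hi; [constructor 1|constructor 2|constructor 3];
  by apply: val_inj; rewrite /= ?inordK.
Qed.

Lemma lift0_ord0 : lift ord0 ord0 = inord 1 :> 'I_3.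
Proof. by apply: val_inj; rewrite /= inordK. Qed.

Lemma lift0_lift0_ord0 : lift ord0 (lift ord0 ord0) = inord 2 :> 'I_3.
Proof. by apply: val_inj; rewrite /= inordK. Qed.

Lemma vec3_upd3 (R : realType) (i : 'I_3) (p : (R * R) * R) (t : R) :
  vec3 (upd3 i p t) i = t.
Proof. by rewrite /vec3 /upd3; case: i => -[|[|[|//]]]. Qed.

Lemma same_off_upd3 (R : realType) (i : 'I_3) (p : (R * R) * R) (t : R) :
  same_off i (vec3 (upd3 i p t)) (vec3 p).
Proof.
by move=> j; rewrite /vec3 /upd3 -val_eqE; case: i => -[|[|[|//]]] ?;
  case: j => -[|[|[|//]]].
Qed.

Lemma measurable_vec3 (R : realType) (i : 'I_3) :
  measurable_fun setT (fun p : (R * R) * R => vec3 p i).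
Proof.
rewrite /vec3; case: i => -[|[|[|//]]] _ /=.
- exact: (measurableT_comp measurable_fst measurable_fst).
- exact: (measurableT_comp measurable_snd measurable_fst).
- exact: measurable_snd.
Qed.

Lemma measurable_normr_vec3 (R : realType) (i : 'I_3) :
  measurable_fun setT (fun p : (R * R) * R => `|vec3 p i|).
Proof.
exact: (measurableT_comp (@normr_measurable _ _) (measurable_vec3 _ _)).
Qed.

(** By Tonelli, coordinate [i] can be integrated first wherever it sits in the nested product; a
    bound uniform in the other two coordinates survives averaging over them. *)
Lemma integral_prod3_between {R : realType} (G : 'I_3 -> probability R R)
    (i : 'I_3) (f : (R * R) * R -> \bar R) (c e : \bar R) :
  (0 <= c)%E -> measurable_fun setT f -> (forall p, 0 <= f p)%E ->
  (forall p, c <= \int[G i]_t f (upd3 i p t) <= e)%E ->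
  (c <= \int[prod3 G]_p f p <= e)%E.
Proof.
move=> c0 mf f0 cfe.
have msl z : measurable_fun setT (fun q : R * R => f (q, z)).
  exact: measurableT_comp mf (pair2_measurable z).
rewrite /prod3; case: (ord3_cases i) cfe => -> cfe.
- apply: integral_prod_between_fst => // z.
  apply: (@integral_prod_between_fst _ _ _ _ _ _ _ (fun q => f (q, z))) => // v.
  (* The [0] is a placeholder, overwritten by [upd3]. *)
  exact: (cfe ((0, v), z)).
- apply: integral_prod_between_fst => // z.
  apply: (@integral_prod_between_snd _ _ _ _ _ _ _ (fun q => f (q, z))) => // u.
  by have := cfe ((u, 0), z); rewrite /upd3 /= inordK.
- apply: integral_prod_between_snd => // q.
  by have := cfe (q, 0); rewrite /upd3 /= inordK.
Qed.

(** * The sum of the two largest of three values *)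

(** Trades sorting for maxima of pair sums, from which measurability and domination of every pair
    can be read off. *)
Lemma topk_sum2E (R : realType) (a b c : R) :
  topk_sum 2 [:: a; b; c] =
    Order.max (Order.max (a + b) (a + c)) (b + c).
Proof.
rewrite /topk_sum /sort /= /merge /=.
by have [] := leP b a; have [] := leP c a; have [] := leP c b => ? ? ? /=;
  do ?[case: (leP (_ + _) _) => ? /=];
  rewrite !big_cons ?big_nil; lra.
Qed.

Lemma topk_sum2_Llist (R : realType) (I : {set 'I_3}) (o a : 'I_3 -> R) :
  let l i := if i \in I then o i else a i in
  topk_sum 2 (Llist I o a) =
    Order.max (Order.max (l ord0 + l (inord 1)) (l ord0 + l (inord 2)))
              (l (inord 1) + l (inord 2)).
Proof.
move=> l; rewrite /Llist !enum_ordSl enum_ord0 /= topk_sum2E.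
by rewrite lift0_lift0_ord0 lift0_ord0.
Qed.

Lemma le_topk_sum2_Llist (R : realType) (I : {set 'I_3}) (o a : 'I_3 -> R)
    (j k : 'I_3) :
  j != k ->
  (if j \in I then o j else a j) + (if k \in I then o k else a k) <=
    topk_sum 2 (Llist I o a).
Proof.
rewrite topk_sum2_Llist !le_max.
by case: (ord3_cases j) => ->; case: (ord3_cases k) => ->; rewrite ?eqxx// => _;
  rewrite ?lexx ?orbT// addrC lexx ?orbT.
Qed.

(** The profile [a] is kept general to cover both [vec3] and its absolute value. *)
Lemma measurable_topk_sum2_Llist (R : realType) (I : {set 'I_3}) (o : 'I_3 -> R)
    (a : (R * R) * R -> 'I_3 -> R) :
  (forall i, measurable_fun setT (a ^~ i)) ->
  measurable_fun setT (fun p => topk_sum 2 (Llist I o (a p))).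
Proof.
move=> ma; under eq_fun do rewrite topk_sum2_Llist.
have ml i : measurable_fun setT (fun p => if i \in I then o i else a p i).
  by case: (i \in I).
by do !apply: measurable_maxr; apply: measurable_funD.
Qed.

(** * Upper bound for feasible mechanisms, lower bound for fixed designations *)

Section Bounds.
Variables (R : realType) (G : 'I_3 -> probability R R) (o : 'I_3 -> R).
Hypothesis o0 : forall i, 0 <= o i.

(* As [a i >= 0] almost surely, this is the expectation of [a i]; the absolute value
   makes the integrand nonnegative everywhere, so that Tonelli applies even when the
   expectation is infinite. *)
Let mean i : \bar R := (\int[G i]_t `|t|%:E)%E.

Let mean_ge0 i : (0 <= mean i)%E.
Proof. by apply: integral_ge0 => t _; rewrite lee_fin. Qed.

Lemma OBJ_le (k : nat) (x y : 'I_3 -> ('I_3 -> R) -> bool) :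
  feasible k x y -> (OBJ G o x y <= \sum_(i < 3) maxe (o i)%:E (mean i))%E.
Proof.
move=> [_ xy yoff _ mxy].
(* [g i] dominates the contribution of item [i]: once [y i] is fixed, it sees [a i]
   only through [`|a i|], so it can be integrated over [a i] first. *)
pose g i p := o i * (y i (vec3 p))%:R + `|vec3 p i| * (1 - (y i (vec3 p))%:R).
have mabs := @measurable_normr_vec3 R.
have mg i : measurable_fun setT (g i).
  have [_ my] := mxy i.
  apply: measurable_funD; apply: measurable_funM => //.
  exact: measurable_funB.
have g0 i p : 0 <= g i p.
  by rewrite /g; case: (y i _); rewrite ?mulr1 ?subrr ?mulr0 ?add0r ?subr0 ?addr0.
have gint i : (\int[prod3 G]_p (g i p)%:E <= maxe (o i)%:E (mean i))%E.
  suff /andP[] : (0 <= \int[prod3 G]_p (g i p)%:E <= maxe (o i)%:E (mean i))%E by [].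
  apply: (integral_prod3_between G i) => //.
  - exact/measurable_EFinP.
  - by move=> p; rewrite lee_fin.
  move=> p; apply/andP; split; first by apply: integral_ge0 => t _; rewrite lee_fin.
  have yE t : y i (vec3 (upd3 i p t)) = y i (vec3 p).
    by apply: yoff; exact: same_off_upd3.
  under eq_integral do rewrite /g yE vec3_upd3.
  case: (y i _) => /=.
  - under eq_integral do rewrite mulr1 subrr mulr0 addr0.
    by rewrite integral_cst//= probability_setT mule1 le_max lexx.
  - under eq_integral do rewrite mulr0 subr0 mulr1 add0r.
    by rewrite le_max lexx orbT.
rewrite /OBJ /Ex3; set f := fun p => _.
apply: (@le_trans _ _ (\int[prod3 G]_p (\sum_(i < 3) (g i p)%:E))%E).
  (* The integrand [f] may be negative; dropping its negative part can only increase the integral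
     and leaves nonnegative functions to compare. *)
  apply: (@le_trans _ _ (\int[prod3 G]_p f^\+ p)%E).
    rewrite integralE; apply: geeDl; rewrite oppe_le0.
    by apply: integral_ge0.
  apply: ge0_le_integral => //.
  - apply: measurable_funepos; apply/measurable_EFinP.
    apply: measurable_sum => i; have [mx my] := mxy i.
    by apply: measurable_funD; apply: measurable_funM => //; exact: measurable_vec3.
  - by apply: emeasurable_sum => i; exact/measurable_EFinP.
  - move=> p _; rewrite funeposE ge_max; apply/andP; split; last first.
      by apply: sume_ge0 => i _; rewrite lee_fin.
    rewrite /f sumEFin lee_fin; apply: ler_sum => i _; rewrite /g addrC lerD2l.
    (* With the organic terms cancelled, [a_i x_i <= |a_i| (1 - y_i)] remains; it holds since no
       item is shown in both forms. *)
    have := xy (vec3 p) i; case: (x i _); case: (y i _) => //= _;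
      rewrite ?mulr0 ?mulr1 ?subr0 ?subrr ?mulr1 ?mulr0 //; exact: ler_norm.
rewrite ge0_integral_sum//; last 2 first.
  by move=> i; exact/measurable_EFinP.
  by move=> i p _; rewrite lee_fin.
by apply: lee_sum => i _.
Qed.

Hypothesis G0 : forall i, G i [set` `]-oo, 0[] = 0%E.

(** For each [i], integrating the indicator of [vec3 p i < 0] over coordinate [i] first gives 0 by
    [G0]; finitely many null sets remain null together. *)
Lemma vec3_ge0_ae : {ae prod3 G, forall p, forall i, 0 <= vec3 p i}.
Proof.
apply: filter_forall => i.
pose A : set ((R * R) * R) := [set p | vec3 p i < 0].
have mA : measurable A.
  rewrite -[A]setTI; rewrite (_ : A = (fun p => vec3 p i) @^-1` [set` `]-oo, 0[]).
    exact: measurable_vec3.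
  by apply/seteqP; split => p; rewrite /A /= in_itv.
suff A0 : prod3 G A = 0%E.
  apply: negligibleS ((negligibleP _ mA).2 A0) => p /= /negP.
  by rewrite -ltNge.
have <- : (\int[prod3 G]_p (\1_A p)%:E = prod3 G A)%E.
  by rewrite integral_indic//= setIT.
have /andP[h h'] : (0 <= \int[prod3 G]_p (\1_A p)%:E <= 0)%E.
  apply: (integral_prod3_between G i) => //.
  - by apply/measurable_EFinP.
  - move=> p; suff -> : (\int[G i]_t (\1_A (upd3 i p t))%:E = 0)%E by rewrite lexx.
    transitivity (\int[G i]_t (\1_[set` `]-oo, (0 : R)[%R] t)%:E)%E; last first.
      by rewrite integral_indic//= setIT.
    apply: eq_integral => t _; congr _%:E.
    rewrite !indicE; congr (_%:R); congr nat_of_bool.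
    by apply/idP/idP; rewrite !inE /A /= vec3_upd3 in_itv.
by apply/eqP; rewrite eq_le h h'.
Qed.

(** The bound is proved pointwise for the values [|a i|], integrated, and carried back to [a i] by
    almost sure nonnegativity. *)
Lemma OBJ_FIX_I_ge (I : {set 'I_3}) (j k : 'I_3) : j != k ->
  ((if j \in I then (o j)%:E else mean j) + (if k \in I then (o k)%:E else mean k)
    <= OBJ_FIX_I G o 2 I)%E.
Proof.
move=> jk; pose l p i := if i \in I then o i else `|vec3 p i|.
have mabs := @measurable_normr_vec3 R.
have ml i : measurable_fun setT (l ^~ i) by rewrite /l; case: (i \in I).
have l0 p i : 0 <= l p i by rewrite /l; case: (i \in I).
have lint i : ((if i \in I then (o i)%:E else mean i) <=
    \int[prod3 G]_p (l p i)%:E)%E.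
  (* The upper bound [+oo] is vacuous and only fits the two-sided form. *)
  suff /andP[] : ((if i \in I then (o i)%:E else mean i) <=
      \int[prod3 G]_p (l p i)%:E <= +oo)%E by [].
  apply: (integral_prod3_between G i) => //.
  - by case: (i \in I); rewrite ?lee_fin.
  - exact/measurable_EFinP.
  - by move=> p; rewrite lee_fin.
  move=> p; rewrite leey andbT /l; case: (i \in I).
    by rewrite integral_cst//= probability_setT mule1.
  by under eq_integral do rewrite vec3_upd3.
apply: (@le_trans _ _ (\int[prod3 G]_p ((l p j)%:E + (l p k)%:E))%E).
  rewrite ge0_integralD//; first exact: leeD.
  - by move=> p _; rewrite lee_fin.
  - exact/measurable_EFinP.
  - by move=> p _; rewrite lee_fin.
  - exact/measurable_EFinP.
pose f p := topk_sum 2 (Llist I o (fun i => `|vec3 p i|)).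
apply: (@le_trans _ _ (\int[prod3 G]_p (f p)%:E)%E).
  apply: ge0_le_integral => //.
  - by move=> p _; rewrite lee_fin addr_ge0.
  - by apply/measurable_EFinP; exact: measurable_funD.
  - apply/measurable_EFinP; exact: measurable_topk_sum2_Llist.
  - by move=> p _; rewrite lee_fin; exact: le_topk_sum2_Llist.
rewrite /OBJ_FIX_I /Ex3 [leRHS](ae_eq_integral (EFin \o f))//.
- apply/measurable_EFinP; apply: measurable_topk_sum2_Llist => i.
  exact: measurable_vec3.
- apply/measurable_EFinP; exact: measurable_topk_sum2_Llist.
- apply: filterS vec3_ge0_ae => p p0 _; congr (topk_sum 2 (Llist I o _))%:E.
  by apply/funext => i; rewrite ger0_norm.
Qed.

End Bounds.

(* n = 3 items, k = 2 slots: for every feasible mechanism M (in particular an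
   optimal one), OBJ(M^F) >= (4/5)^3 OBJ(M). *)
Theorem theorem2 (R : realType) (G : 'I_3 -> probability R R) (o : 'I_3 -> R) :
  (forall i, regular (G i)) ->
  (forall i, G i [set` `]-oo, 0[] = 0%E) ->
  (forall i, 0 <= o i) ->
  forall x y : 'I_3 -> ('I_3 -> R) -> bool,
    feasible 2 x y ->
    (((4 / 5) ^+ 3)%:E * OBJ G o x y <= OBJ_FIX G o 2)%E.
Proof.
move=> _ G0 o0 x y xy.
have := @OBJ_le R G o o0 2 x y xy.
pose mean i : \bar R := (\int[G i]_t `|t|%:E)%E.
pose M i := maxe (o i)%:E (mean i).
rewrite -/(mean _) (eq_bigr M)// => OBJM.
have M0 i : (0 <= M i)%E by rewrite le_max lee_fin o0.
have FIXM j k : j != k -> (M j + M k <= OBJ_FIX G o 2)%E.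
  (* Each item of the pair gets its better form, so its expected entry is [M i]; staying inside the
     pair ensures [#|I| <= 2]. *)
  move=> jk; pose I := [set i in [set j; k]%SET | (mean i <= (o i)%:E)%E].
  have I2 : (#|I| <= 2)%N.
    suff : (#|I| <= #|[set j; k]%SET|)%N by rewrite cards2 jk.
    apply: subset_leq_card; apply/fintype.subsetP => i.
    by rewrite inE => /andP[].
  have FI : (OBJ_FIX_I G o 2 I <= OBJ_FIX G o 2)%E.
    exact: (@le_bigmax_cond _ _ _ -oo%E I (fun J => (#|J| <= 2)%N)).
  apply: le_trans FI.
  apply: le_trans (@OBJ_FIX_I_ge R G o o0 G0 I _ _ jk).
  have IE i : i \in [set j; k]%SET ->
      (if i \in I then (o i)%:E else mean i) = M i.
    by rewrite [i \in I]inE => -> /=; rewrite /M; case: leP.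
  by rewrite -/(mean j) -/(mean k) !IE// !inE eqxx ?orbT.
have n01 : (ord0 : 'I_3) != inord 1 by rewrite -val_eqE /= inordK.
have n02 : (ord0 : 'I_3) != inord 2 by rewrite -val_eqE /= inordK.
have n12 : (inord 1 : 'I_3) != inord 2 by rewrite -val_eqE /= !inordK.
have {}OBJM : (OBJ G o x y <= M ord0 + M (inord 1) + M (inord 2))%E.
  apply: le_trans OBJM _; rewrite !big_ord_recl big_ord0 adde0 addeA.
  by rewrite lift0_lift0_ord0 lift0_ord0.
move: (FIXM _ _ n01) (FIXM _ _ n02) (FIXM _ _ n12) OBJM.
move: (M0 ord0) (M0 (inord 1)) (M0 (inord 2)).
(* A finite value forces all [M i] to be finite, [+oo] is trivial, and [-oo] contradicts
   [0 <= M i]. *)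
case: (OBJ_FIX G o 2) => [F| |].
- case: (M ord0) => [a||]; case: (M (inord 1)) => [b||];
    case: (M (inord 2)) => [c||] //; rewrite -?EFinD ?lee_fin.
  move=> a0 b0 c0 ab ac bc OBJM.
  apply: (@le_trans _ _ ((4 / 5) ^+ 3 * (a + b + c))%:E).
    rewrite (EFinM (_ ^+ _)); apply: lee_wpmul2l;
      by rewrite ?lee_fin// exprn_ge0// divr_ge0.
  (* Adding the pair bounds gives [2 (a + b + c) <= 3 F], and [64/125 <= 2/3] with
     [a + b + c >= 0]. *)
  by rewrite lee_fin; lra.
- by move=> *; rewrite leey.
- by case: (M ord0) => [a||]; case: (M (inord 1)) => [b||].
Qed.
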